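(* Let $\mathbf{A}=[\underline A,\overline A]\subseteq\mathbb{R}^{m\times n}$ be an interval matrix and $\mathbf{b}=[\underline b,\overline b]\subseteq\mathbb{R}^m$, $\mathbf{c}=[\underline c,\overline c]\subseteq\mathbb{R}^n$ interval vectors. The type (A) interval linear program $\min\{\mathbf{c}^{\top}x : \mathbf{A}x=\mathbf{b},\ x\ge 0\}$ has weakly zero duality gap if and only if at least one of the following conditions holds: (i) the linear system $\underline{A}x\le\overline{b},\ -\overline{A}x\le-\underline{b},\ x\ge 0$ is feasible; (ii) there exists $p\in\{\pm1\}^m$ such that the linear system $(A_c-\mathrm{diag}(p)\,A_\Delta)^{\top}y\le\overline{c}$ is feasible.
   Context: For real matrices $\underline{A}\le\overline{A}$ (entrywise), $\mathbf{A}=[\underline{A},\overline{A}]=\{A:\underline{A}\le A\le\overline{A}\}$; interval vectors are defined analogously. $A_c=\frac12(\underline A+\overline A)$ is the center matrix, $A_\Delta=\frac12(\overline A-\underline A)$ the radius matrix, and $\mathrm{diag}(p)$ is the diagonal matrix with diagonal entries the entries of $p$. The type (A) interval linear program is the family of linear programs $\min\{c^{\top}x: Ax=b,\ x\ge 0\}$ over all scenarios $(A,b,c)$ with $A\in\mathbf{A}$, $b\in\mathbf{b}$, $c\in\mathbf{c}$. The dual of the scenario $(A,b,c)$ is $\max\{b^{\top}y: A^{\top}y\le c\}$, $y\in\mathbb{R}^m$. A scenario has zero duality gap if and only if at least one of its primal and dual linear programs is feasible (otherwise the duality gap is $\infty$). The duality gap of the interval linear program is weakly zero if at least one scenario has zero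 duality gap. *)

(* Defs.v *)
(* Vectors of R^k are columns 'cV[R]_k. *)
From HB Require Import structures.
From mathcomp Require Import all_boot all_order all_algebra.
From mathcomp Require Import boolp classical_sets reals constructive_ereal ereal.
Set Implicit Arguments.
Unset Strict Implicit.
Unset Printing Implicit Defensive.
Import Order.TTheory GRing.Theory Num.Theory.
Local Open Scope classical_set_scope.
Local Open Scope ring_scope.

Definition mxle (R : realType) (m n : nat) (A B : 'M[R]_(m, n)) : Prop :=
  forall i j, A i j <= B i j.
Notation "A <=mx B" := (mxle A B) (at level 70, no associativity).

Definition interval_mx (R : realType) (m n : nat) (Al Au : 'M[R]_(m, n)) :
  set 'M[R]_(m, n) := [set A | Al <=mx A /\ A <=mx Au].

Definition interval_center (R : realType) (m n : nat) (Al Au : 'M[R]_(m, n)) :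
  'M[R]_(m, n) := 2^-1 *: (Al + Au).

Definition interval_radius (R : realType) (m n : nat) (Al Au : 'M[R]_(m, n)) :
  'M[R]_(m, n) := 2^-1 *: (Au - Al).

(* A row vector because diag_mx takes one. *)
Definition sign_vector (R : realType) (m : nat) (p : 'rV[R]_m) : Prop :=
  forall i, p 0 i = 1 \/ p 0 i = -1.

Definition primal_feasible (R : realType) (m n : nat)
  (A : 'M[R]_(m, n)) (b : 'cV[R]_m) : set 'cV[R]_n :=
  [set x | A *m x = b /\ 0 <=mx x].

Definition dual_feasible (R : realType) (m n : nat)
  (A : 'M[R]_(m, n)) (c : 'cV[R]_n) : set 'cV[R]_m :=
  [set y | A^T *m y <=mx c].

Definition dotv (R : realType) (k : nat) (u v : 'cV[R]_k) : R :=
  (u^T *m v) 0 0.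

(* +oo when the primal is infeasible, -oo when it is unbounded. *)
Definition primal_value (R : realType) (m n : nat)
  (A : 'M[R]_(m, n)) (b : 'cV[R]_m) (c : 'cV[R]_n) : \bar R :=
  ereal_inf [set (dotv c x)%:E | x in primal_feasible A b].

(* -oo when the dual is infeasible, +oo when it is unbounded. *)
Definition dual_value (R : realType) (m n : nat)
  (A : 'M[R]_(m, n)) (b : 'cV[R]_m) (c : 'cV[R]_n) : \bar R :=
  ereal_sup [set (dotv b y)%:E | y in dual_feasible A c].

(* Difference of the optimal values; the case distinction only fixes the
   indeterminate differences of two equal infinities, whose gap is 0.  If both
   programs are infeasible the gap is +oo - -oo = +oo. *)
Definition duality_gap (R : realType) (m n : nat)
  (A : 'M[R]_(m, n)) (b : 'cV[R]_m) (c : 'cV[R]_n) : \bar R :=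
  if primal_value A b c == dual_value A b c then 0%E
  else (primal_value A b c - dual_value A b c)%E.

Definition weakly_zero_duality_gap (R : realType) (m n : nat)
  (Al Au : 'M[R]_(m, n)) (bl bu : 'cV[R]_m) (cl cu : 'cV[R]_n) : Prop :=
  exists A b c, [/\ interval_mx Al Au A, interval_mx bl bu b,
    interval_mx cl cu c & duality_gap A b c = 0%E].

(* Main.v *)
Require Import Defs.
From mathcomp Require Import all_boot all_order all_algebra.
From mathcomp Require Import boolp classical_sets reals constructive_ereal ereal.
From mathcomp Require Import lra.
Import Order.TTheory GRing.Theory Num.Theory.
Local Open Scope ring_scope.

(** A scenario has duality gap [0] exactly when its primal or its dual program
    is feasible ([duality_gap_eq0]), so a weakly zero gap means that some
    scenario is primal feasible or some scenario is dual feasible.  The two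
    conditions of the theorem describe these two possibilities.

    That feasibility forces a zero gap is linear programming duality, derived
    here from Farkas' lemma.  Attainment of the optimal values is not at stake,
    so it is enough to see that no real [t] separates them.
    [lp_threshold] does this for all feasible programs at once: Farkas' lemma
    for the primal constraints together with the objective bound [c^T x <= t]
    gives a primal point of value at most [t] or a dual point of value above
    [t].

    For the primal side, fix [x >= 0].  As [A] runs over the interval matrix,
    the rows vary independently and the i-th entry of [A x] fills the segment
    from [(Al x)_i] to [(Au x)_i]; the equation is solvable when each such
    segment meets [[bl_i, bu_i]] ([interval_system_solvable]).

    For the dual side, fix [y] with sign vector [p].  The matrix
    [A_c - diag(p) A_Delta] has the lower bounds in the rows with [y_i >= 0] and
    the upper bounds in the others, so that it minimizes all entries of [A^T y]
    simultaneously.  It is itself a scenario, and the weakest right-hand side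
    is [cu] ([interval_ineq_solvable]). *)

(** * Farkas' lemma *)

Lemma mxle_mul2r (R : realType) (m n k : nat) (A B : 'M[R]_(m, n))
    (X : 'M[R]_(n, k)) :
  A <=mx B -> 0 <=mx X -> A *m X <=mx B *m X.
Proof.
move=> leAB X_ge0 i j; rewrite !mxE; apply: ler_sum => l _.
by apply: ler_wpM2r => //; have := X_ge0 l j; rewrite mxE.
Qed.

Arguments mxle_mul2r {R m n k A B X}.

Lemma mxleN2 (R : realType) (m n : nat) (A B : 'M[R]_(m, n)) :
  - A <=mx - B <-> B <=mx A.
Proof. by split=> leAB i j; have := leAB i j; rewrite !mxE lerN2. Qed.

(** Induction on the number of columns, after Bartl.  Split off the first
    column [a].  If the hypothesis already holds for the other columns [A], the
    weight [0] is given to [a].  Otherwise some [y1] with [y1 A <= 0] has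
    [y1 b >= 0] and, after scaling, [y1 a = 1].  The projection
    [P = 1 - a y1] kills [a], so the hypothesis passes to [P A] and [P b];
    a nonnegative solution of [P A x = P b] solves the original system up to a
    multiple of [a], and that multiple [y1 b - y1 A x] is nonnegative. *)
Lemma farkas_row (R : realType) (m n : nat) (A : 'M[R]_(m, n)) (b : 'cV[R]_m) :
  (forall y : 'rV[R]_m, y *m A <=mx 0 -> (y *m b) 0 0 <= 0) ->
  exists2 x : 'cV[R]_n, A *m x = b & 0 <=mx x.
Proof.
elim: n => [|n IHn] in A b *.
  move=> Ab; exists 0; last by case.
  rewrite mulmx0; apply/esym/colP => i.
  have row_le (s : R) : s * b i 0 <= 0.
    have /Ab : (s *: delta_mx 0 i : 'rV[R]_m) *m A <=mx 0 by move=> ? [].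
    by rewrite -scalemxAl mxE -rowE mxE.
  (* Without columns every y is admissible, in particular both signs of e_i. *)
  have := row_le 1; have := row_le (-1); rewrite mxE; lra.
move: A; rewrite -[n.+1]/(1 + n)%N => A; rewrite -[A]hsubmxK.
move: (lsubmx _) (rsubmx _) => a {}A Ab.
have A_le (y : 'rV[R]_m) :
    (y *m a) 0 0 <= 0 -> y *m A <=mx 0 -> (y *m b) 0 0 <= 0.
  move=> ya yA; apply: Ab; rewrite mul_mx_row => i j.
  by rewrite !mxE; case: splitP => k _; [have := ya | have := yA i k];
    rewrite !ord1 ?mxE.
have [/IHn[x Ax x_ge0]|] :=
    pselect (forall y : 'rV[R]_m, y *m A <=mx 0 -> (y *m b) 0 0 <= 0).
  exists (col_mx (0 : 'cV_1) x); first by rewrite mul_row_col mulmx0 add0r.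
  by move=> i j; rewrite !mxE; case: splitP => k _; have := x_ge0;
    [rewrite mxE | move/(_ k j); rewrite mxE].
move=> /existsNP[y0 /not_implyP[y0A /negP]]; rewrite -ltNge => y0b.
have y0a : 0 < (y0 *m a) 0 0.
  by rewrite ltNge; apply/negP => /A_le/(_ y0A); rewrite leNgt y0b.
have y0aE := mx11_scalar (y0 *m a).
move: (_ 0 0) y0a y0aE => al al_gt0 y0aE.
have [y1 [y1a y1A y1b]] : exists y1 : 'rV[R]_m,
    [/\ y1 *m a = 1%:M, y1 *m A <=mx 0 & 0 <= (y1 *m b) 0 0].
  exists (al^-1 *: y0); rewrite -!scalemxAl; split.
  - by rewrite y0aE scale_scalar_mx mulVf // gt_eqF.
  - move=> i j; have := y0A i j.
    move: (y0 *m A) => v; rewrite !mxE => y0Aij.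
    by rewrite pmulr_rle0 // invr_gt0.
  - by rewrite mxE mulr_ge0 ?invr_ge0 // ltW.
pose P := 1%:M - a *m y1.
have Pa : P *m a = 0 by rewrite mulmxBl mul1mx -mulmxA y1a mulmx1 subrr.
have [|x PAx x_ge0] := IHn (P *m A) (P *m b).
  move=> y yPA; rewrite mulmxA; apply: A_le; last by rewrite -mulmxA.
  by rewrite -mulmxA Pa mulmx0 mxE.
exists (col_mx (y1 *m b - y1 *m A *m x) x).
  move: PAx; rewrite -mulmxA !mulmxBl !mul1mx -!mulmxA => PAx.
  rewrite mul_row_col mulmxBr.
  rewrite -[X in _ + X = _](subrK (a *m (y1 *m (A *m x)))) PAx.
  by rewrite (addrC (b - _)) addrA subrK addrC subrK.
have y1Ax := mxle_mul2r y1A x_ge0.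
move=> i j; rewrite !mxE; case: splitP => k _; last first.
  by have := x_ge0 k j; rewrite mxE.
have := y1Ax 0 0; rewrite !ord1 mul0mx; move: y1b; rewrite !mxE; lra.
Qed.

Lemma farkas (R : realType) (m n : nat) (A : 'M[R]_(m, n)) (b : 'cV[R]_m) :
  (exists x, primal_feasible A b x) \/
  (exists2 y : 'cV[R]_m, A^T *m y <=mx 0 & 0 < dotv b y).
Proof.
have [[x [Ax x_ge0]]|] :=
    pselect (exists x, primal_feasible A b x); first by left; exists x.
move=> noX; right; apply: contrapT => noY; apply: noX.
have [|x Ax x_ge0] := @farkas_row R m n A b; last by exists x.
move=> y yA; rewrite leNgt; apply/negP => yb; apply: noY; exists y^T.
  by rewrite -trmx_mul => i j; have := yA j i; rewrite !mxE.
by rewrite /dotv -trmx_mul mxE.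
Qed.

Arguments farkas {R m n} A b.

(** * Linear programming duality *)

Lemma weak_duality (R : realType) (m n : nat) (A : 'M[R]_(m, n))
    (b : 'cV[R]_m) (c : 'cV[R]_n) (x : 'cV[R]_n) (y : 'cV[R]_m) :
  primal_feasible A b x -> dual_feasible A c y -> dotv b y <= dotv c x.
Proof.
move=> [<- x_ge0] yc.
have yAc : y^T *m A <=mx c^T.
  by move=> i j; have := yc j i; rewrite -{1}[y]trmxK -trmx_mul !mxE.
have := mxle_mul2r yAc x_ge0 0 0.
rewrite -mulmxA /dotv.
have -> : (A *m x)^T *m y = (y^T *m (A *m x))^T by rewrite [RHS]trmx_mul trmxK.
by rewrite [X in _ -> X <= _]mxE.
Qed.

Lemma dotvDr (R : realType) (k : nat) (u v w : 'cV[R]_k) :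
  dotv u (v + w) = dotv u v + dotv u w.
Proof. by rewrite /dotv mulmxDr mxE. Qed.

Lemma dotvZr (R : realType) (k : nat) (a : R) (u v : 'cV[R]_k) :
  dotv u (a *: v) = a * dotv u v.
Proof. by rewrite /dotv -scalemxAr mxE. Qed.

(** The objective bound becomes the equation [c^T x + s = t] with a slack
    [s >= 0].  A Farkas certificate [(z, y)] against the enlarged system has
    [z <= 0].  If [z < 0], then [y / -z] is dual feasible of value above [t].
    If [z = 0], then [y] certifies primal infeasibility; some dual point exists
    by assumption, and moving it far enough along [y] makes its value exceed
    [t]. *)
Lemma lp_threshold (R : realType) (m n : nat) (A : 'M[R]_(m, n))
    (b : 'cV[R]_m) (c : 'cV[R]_n) (t : R) :
  (exists x, primal_feasible A b x) \/ (exists y, dual_feasible A c y) ->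
  (exists2 x, primal_feasible A b x & dotv c x <= t) \/
  (exists2 y, dual_feasible A c y & t < dotv b y).
Proof.
move=> feas.
have [[x []]|[y]] := farkas (block_mx c^T (1%:M : 'M_1) A 0) (col_mx t%:M b).
  rewrite -[x]vsubmxK; move: (usubmx x) (dsubmx x) => {}x s.
  rewrite mul_block_col mul0mx addr0 mul1mx => /eq_col_mx[cx Ax] xs_ge0.
  left; exists x.
    split=> // i j; have := xs_ge0 (lshift 1 i) j.
    by rewrite col_mxEu !mxE.
  have := xs_ge0 (rshift n ord0) 0; rewrite col_mxEd mxE => s_ge0.
  have := congr1 (fun M : 'M_1 => M 0 0) cx.
  rewrite mxE [X in _ = X]mxE /dotv mulr1n; move: s_ge0; rewrite mxE; lra.
rewrite -[y]vsubmxK; move: (usubmx y) (dsubmx y) => z {}y.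
rewrite tr_block_mx trmxK trmx1 trmx0 mul_block_col mul0mx addr0 mul1mx.
rewrite [z]mx11_scalar; move: (z 0 0) => {}z; rewrite mul_mx_scalar => Ay.
have z_le0 : z <= 0.
  by have := Ay (rshift n ord0) 0; rewrite col_mxEd !mxE eqxx mulr1n.
have Ayz j : (A^T *m y) j 0 <= - z * c j 0.
  have := Ay (lshift 1 j) 0; rewrite col_mxEu mxE [X in X + _]mxE.
  rewrite [X in _ <= X]mxE; lra.
have -> : dotv (col_mx t%:M b) (col_mx z%:M y) = t * z + dotv b y.
  rewrite /dotv tr_col_mx mul_row_col tr_scalar_mx mul_scalar_mx mxE.
  by congr (_ + _); rewrite !mxE eqxx mulr1n.
move=> bTy_gt; right.
have [z0|z_neq0] := eqVneq z 0; last first.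
  have z_lt0 : 0 < - z by rewrite oppr_gt0 lt_neqAle z_neq0.
  exists ((- z)^-1 *: y).
    by move=> j k; rewrite -scalemxAr mxE ord1 ler_pdivrMl.
  by rewrite dotvZr ltr_pdivlMl //; lra.
have Ay_le0 : A^T *m y <=mx 0.
  by move=> j k; rewrite ord1 (le_trans (Ayz j)) // z0 oppr0 mul0r mxE.
have bTy_gt0 : 0 < dotv b y by move: bTy_gt; rewrite z0; lra.
case: feas => [[x /weak_duality/(_ Ay_le0)]|[y0 y0c]].
  by rewrite leNgt /dotv trmx0 mul0mx mxE bTy_gt0.
(* The first nonnegative multiple of y that lifts the value at y0 to t; the
   added 1 makes the inequality strict. *)
pose k := Num.max 0 ((t - dotv b y0) / dotv b y) + 1.
have k_gt0 : 0 < k by rewrite ltr_wpDl // le_max lexx.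
exists (y0 + k *: y); last first.
  have : (t - dotv b y0) / dotv b y < k by rewrite ltr_pwDr // le_max lexx orbT.
  by rewrite ltr_pdivrMr // dotvDr dotvZr; lra.
move=> i j; rewrite mulmxDr -scalemxAr mxE [X in _ + X]mxE.
have := Ay_le0 i j; rewrite [X in _ <= X -> _]mxE.
rewrite -(pmulr_rle0 _ k_gt0); have := y0c i j; lra.
Qed.

Arguments lp_threshold {R m n A b c} t.

Lemma lte_between (R : realType) (x y : \bar R) :
  (x < y)%E -> exists t : R, (x < t%:E)%E /\ (t%:E < y)%E.
Proof.
case: x y => [r||] [s||] //= xy.
- by exists ((r + s) / 2); rewrite !lte_fin in xy *; split; lra.
- by exists (r + 1); rewrite ltry lte_fin ltrDl ltr01.
- by exists (s - 1); rewrite ltNyr lte_fin gtrBl ltr01.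
- by exists 0; rewrite ltry ltNyr.
Qed.

Lemma strong_duality (R : realType) (m n : nat) (A : 'M[R]_(m, n))
    (b : 'cV[R]_m) (c : 'cV[R]_n) :
  (exists x, primal_feasible A b x) \/ (exists y, dual_feasible A c y) ->
  primal_value A b c = dual_value A b c.
Proof.
move=> feas; apply/eqP; rewrite eq_le; apply/andP; split; last first.
  apply: ge_ereal_sup => _ [y yc <-]; apply: le_ereal_inf_tmp => _ [x xb <-].
  by rewrite lee_fin; apply: weak_duality xb yc.
rewrite leNgt; apply/negP => /lte_between[t [ltDt ltP]].
have [[x xb xt]|[y yc ty]] := lp_threshold t feas.
  have : (primal_value A b c <= (dotv c x)%:E)%E.
    by apply: ereal_inf_lbound; exists x.
  by move=> /(lt_le_trans ltP); rewrite lte_fin ltNge xt.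
have : ((dotv b y)%:E <= dual_value A b c)%E.
  by apply: ereal_sup_ubound; exists y.
by move=> /le_lt_trans/(_ ltDt); rewrite lte_fin ltNge ltW.
Qed.

(** If both programs are infeasible, the values are [+oo] and [-oo], and the
    gap is [+oo]. *)
Lemma duality_gap_eq0 (R : realType) (m n : nat) (A : 'M[R]_(m, n))
    (b : 'cV[R]_m) (c : 'cV[R]_n) :
  duality_gap A b c = 0%E <->
  (exists x, primal_feasible A b x) \/ (exists y, dual_feasible A c y).
Proof.
split=> [|/strong_duality eqPD]; last by rewrite /duality_gap eqPD eqxx.
move=> gap0; apply: contrapT => /not_orP[noX noY]; move: gap0.
have Pinf : primal_value A b c = +oo%E.
  rewrite /primal_value (_ : primal_feasible A b = set0) ?image_set0 ?ereal_inf0 //.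
  by apply/seteqP; split=> // x xb; case: noX; exists x.
have Dinf : dual_value A b c = -oo%E.
  rewrite /dual_value (_ : dual_feasible A c = set0) ?image_set0 ?ereal_sup0 //.
  by apply/seteqP; split=> // y yc; case: noY; exists y.
by rewrite /duality_gap Pinf Dinf.
Qed.

(** * Interval systems *)

Lemma segment_meets_interval (R : realType) (a b l u : R) :
  a <= u -> l <= b -> l <= u ->
  exists t, 0 <= t <= 1 /\ l <= a + t * (b - a) <= u.
Proof.
move=> au lb lu; have [la|al] := leP l a.
  by exists 0; rewrite lexx ler01 mul0r addr0 la au.
have ba : 0 < b - a by lra.
exists ((l - a) / (b - a)); rewrite divfK ?gt_eqF //.
by rewrite ler_pdivrMr // divr_ge0 //; lra.
Qed.

(** The theorem of Oettli and Prager for nonnegative [x].  Since [x >= 0], the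
    extreme values of [A x] are [Al x] and [Au x]; conversely one weight [t i]
    per row moves that row from [Al] to [Au] until its product with [x] enters
    the interval of the right-hand side. *)
Lemma interval_system_solvable (R : realType) (m n : nat)
    (Al Au : 'M[R]_(m, n)) (bl bu : 'cV[R]_m) (x : 'cV[R]_n)
    (hA : Al <=mx Au) (hb : bl <=mx bu) : 0 <=mx x ->
  (exists A b, [/\ interval_mx Al Au A, interval_mx bl bu b & A *m x = b]) <->
  (Al *m x <=mx bu /\ bl <=mx Au *m x).
Proof.
move=> x_ge0; split=> [[A [b [[lA uA] [lb ub] Ax]]]|[lx ux]].
  split=> i j.
    by apply: le_trans (ub i j); rewrite -Ax; apply: mxle_mul2r.
  by apply: le_trans (lb i j) _; rewrite -Ax; apply: mxle_mul2r.
have row_weight i : exists t, 0 <= t <= 1 /\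
    bl i 0 <= (Al *m x) i 0 + t * ((Au *m x) i 0 - (Al *m x) i 0) <= bu i 0.
  exact: segment_meets_interval.
have [t tP] := choice row_weight.
pose A := Al + diag_mx (\row_i t i) *m (Au - Al).
have AE i j : A i j = Al i j + t i * (Au i j - Al i j).
  by rewrite /A mul_diag_mx !mxE.
exists A, (A *m x); split=> //.
  by split=> i j; rewrite AE; have [/andP[? ?] _] := tP i; have := hA i j; nra.
have AxE i : (A *m x) i 0 =
    (Al *m x) i 0 + t i * ((Au *m x) i 0 - (Al *m x) i 0).
  by rewrite /A mulmxDl -mulmxA mulmxBl mul_diag_mx !mxE.
by split=> i j; rewrite ord1 AxE; have [_ /andP[]] := tP i.
Qed.

Arguments interval_system_solvable {R m n Al Au bl bu x}.

Lemma sign_matrixE (R : realType) (m n : nat) (Al Au : 'M[R]_(m, n))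
    (p : 'rV[R]_m) i j : sign_vector p ->
  (interval_center Al Au - diag_mx p *m interval_radius Al Au) i j =
  if p 0 i == 1 then Al i j else Au i j.
Proof.
move=> sp; rewrite mul_diag_mx !mxE.
have [->|->] := sp i; first by rewrite eqxx; lra.
by rewrite eqNr oner_eq0; lra.
Qed.

(** Gerlach's theorem.  Taking [p] to be the sign pattern of a solution [y]
    makes every term [A_ij y_i] as small as the interval matrix allows. *)
Lemma interval_ineq_solvable (R : realType) (m n : nat)
    (Al Au : 'M[R]_(m, n)) (cl cu : 'cV[R]_n)
    (hA : Al <=mx Au) (hc : cl <=mx cu) :
  (exists A c, [/\ interval_mx Al Au A, interval_mx cl cu c
                  & exists y, dual_feasible A c y]) <->
  (exists p : 'rV[R]_m, sign_vector p /\ exists y : 'cV[R]_m,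
     (interval_center Al Au - diag_mx p *m interval_radius Al Au)^T *m y
       <=mx cu).
Proof.
split=> [[A [c [[lA uA] [_ cu_ge] [y yc]]]]|[p [sp [y yc]]]].
  pose p : 'rV[R]_m := \row_i (if 0 <= y i 0 then 1 else -1).
  have sp : sign_vector p.
    by move=> i; rewrite mxE; case: ifP; [left | right].
  exists p; split=> //; exists y => j k.
  apply: le_trans (cu_ge j k); apply: le_trans (yc j k).
  rewrite mxE [X in _ <= X]mxE; apply: ler_sum => i _.
  rewrite mxE [A^T j i]mxE sign_matrixE // ord1 mxE.
  have [y_ge0|y_lt0] := leP 0 (y i 0).
    by rewrite eqxx ler_wpM2r.
  by rewrite eqNr oner_eq0 ler_wnM2r // ltW.
exists (interval_center Al Au - diag_mx p *m interval_radius Al Au), cu.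
split; last by exists y.
  by split=> i j; rewrite sign_matrixE //; case: ifP.
by split.
Qed.

Theorem corollary2 (R : realType) (m n : nat)
  (Al Au : 'M[R]_(m, n)) (bl bu : 'cV[R]_m) (cl cu : 'cV[R]_n)
  (hA : Al <=mx Au) (hb : bl <=mx bu) (hc : cl <=mx cu) :
  weakly_zero_duality_gap Al Au bl bu cl cu <->
  (exists x : 'cV[R]_n,
     [/\ Al *m x <=mx bu, - Au *m x <=mx - bl & 0 <=mx x])
  \/
  (exists p : 'rV[R]_m, sign_vector p /\
     exists y : 'cV[R]_m,
       (interval_center Al Au - diag_mx p *m interval_radius Al Au)^T *m y <=mx cu).
Proof.
have oppAu (x : 'cV[R]_n) : - Au *m x <=mx - bl <-> bl <=mx Au *m x.
  by rewrite mulNmx; apply: mxleN2.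
split=> [[A [b [c [A_in b_in c_in /duality_gap_eq0[]]]]]|[[x]|]].
- move=> [x [Ax x_ge0]]; left; exists x.
  have [lx ux] : Al *m x <=mx bu /\ bl <=mx Au *m x.
    by apply/interval_system_solvable => //; exists A, b.
  by split=> //; apply/oppAu.
- move=> yc; right; apply/interval_ineq_solvable; [exact: hA | exact: hc |].
  by exists A, c.
- move=> [lx /oppAu ux x_ge0].
  have [_ /(_ (conj lx ux))[A [b [A_in b_in Ax]]]] :=
    interval_system_solvable hA hb x_ge0.
  exists A, b, cl; split=> //; [by split | apply/duality_gap_eq0].
  by left; exists x.
- move=> /interval_ineq_solvable-/(_ _ hA hc)[A [c [A_in c_in yc]]].
  exists A, bl, c; split=> //; [by split | apply/duality_gap_eq0].
  by right.
Qed.
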